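(* Let $(G,u)$ be a nearly divisible dimension group with order unit, and let $Y=Z(\ker Y)$ be a subset of $S(G,u)$ such that for all $\sigma\in Y$, $\ker\sigma\cap G^+=\{0\}$. Suppose that either $Y$ is a face of $S(G,u)$ or $G/\ker Y$ is unperforated. Then $Y$ is good (with respect to $(G,u)$) if and only if (a) $\phi_I(Y)$ is order unit good (with respect to $(I,w)$) for all nonzero order ideals $I$ of $G$ having their own order unit $w$, and (b) for every nonzero order ideal $I$ of $G$, $I+\ker Y=G+\ker Y$.
   Context: A partially ordered abelian group is unperforated if $ng\ge0$ for some integer $n\ge1$ implies $g\ge0$. A dimension group is a directed unperforated partially ordered abelian group with Riesz interpolation; $u\in G^+$ is an order unit if for every $g\in G$ there is a positive integer $K$ with $-Ku\le g\le Ku$. An order ideal is a convex directed subgroup; it has its own order unit $w$ if $w\in I$ is an order unit of $I$ in the relative ordering. A trace is a nonzero positive group homomorphism to $\mathbb R$; $S(G,u)$ is the compact convex set of traces with $\tau(u)=1$ (point-open topology), $\mathrm{Aff}\,S(G,u)$ the continuous affine real functions on it with sup norm, $\hat g(\tau)=\tau(g)$. $(G,u)$ is approximately divisible if $\{\hat g:g\in G\}$ is norm-dense in $\mathrm{Aff}\,S(G,u)$; $G$ is nearly divisible if every order ideal with its own order unit is approximately divisible. For $Y\subseteq S(G,u)$, $\ker Y=\bigcap_{\sigma\in Y}\ker\sigma$; for $W\subseteq G$, $Z(W)=\{\sigma\in S(G,u):\sigma(w)=0\ \forall w\in W\}$. For a convex subgroup $L$ of $G$, $G/L$ has the quotient ordering: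 $a+L\ge0$ iff $(a+L)\cap G^+\ne\emptyset$. $L$ is a good subgroup of $G$ if (i) $L$ is convex and $G/L$ is unperforated and (ii) for all $b\in G^+$ and $a\in G$ with $0\le a+L\le b+L$ in $G/L$ there is $a'\in G$ with $a-a'\in L$ and $0\le a'\le b$. $Y$ is a good subset (with respect to $(G,u)$) if $Y=Z(\ker Y)$ and $\ker Y$ is a good subgroup of $G$. A compact convex $Y\subseteq S(G,u)$ is order unit good with respect to $(G,u)$ if for every order unit $b$ of $G$ and $a\in G$ with $0\ll\hat a|_Y\ll\hat b|_Y$ there is $a'\in G$ with $\hat a'|_Y=\hat a|_Y$ and $0\le a'\le b$; here $f\ll g$ means $g-f$ is bounded below by a positive constant. For an order ideal $(I,w)$ on which no point of $Y$ vanishes, $\phi_I:Y\to S(I,w)$ is $\sigma\mapsto\sigma|_I/\sigma(w)$. *)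

(* Defs.v *)
From HB Require Import structures.
From mathcomp Require Import all_boot all_order all_algebra.
From mathcomp Require Import all_classical all_reals all_analysis.

Set Implicit Arguments.
Unset Strict Implicit.
Unset Printing Implicit Defensive.

Import Order.TTheory GRing.Theory Num.Theory.
Import numFieldNormedType.Exports.

Local Open Scope classical_set_scope.
Local Open Scope ring_scope.
Local Open Scope convex_scope.

(* [Num.POrderedZmodule] does not relate the order to the addition. *)
HB.mixin Record POrderedZmodule_isPOGroup V of Num.POrderedZmodule V := {
  pogroup_leD : forall x y z : V, x <= y -> x + z <= y + z
}.

#[short(type="pogroupType")]
HB.structure Definition POGroup :=
  { V of POrderedZmodule_isPOGroup V & Num.POrderedZmodule V }.

Section POGroupDefs.
Variable G : pogroupType.
Implicit Types (L : set G) (a b g u x y z : G).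

Definition poscone : set G := [set g | 0 <= g].

Definition unperforated : Prop :=
  forall g (n : nat), (0 < n)%N -> 0 <= g *+ n -> 0 <= g.

Definition directed_set L : Prop :=
  forall x y, L x -> L y -> exists z, [/\ L z, x <= z & y <= z].

Definition riesz_interpolation : Prop :=
  forall x1 x2 y1 y2,
    x1 <= y1 -> x1 <= y2 -> x2 <= y1 -> x2 <= y2 ->
    exists z, [/\ x1 <= z, x2 <= z, z <= y1 & z <= y2].

Definition dimension_group : Prop :=
  [/\ directed_set setT, unperforated & riesz_interpolation].

Definition order_unit u : Prop :=
  0 <= u /\
  forall g, exists K : nat, [/\ (0 < K)%N, - (u *+ K) <= g & g <= u *+ K].

Definition subgroup L : Prop := zmod_closed (mem L).

Definition order_convex L : Prop :=
  forall x y z, L x -> L z -> x <= y -> y <= z -> L y.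

Definition order_ideal L : Prop :=
  [/\ subgroup L, order_convex L & directed_set L].

(* [quot_ge0 L a] is [0 <= a + L] in G/L, i.e. the coset [a + L] meets the
   positive cone; elements of G/L are handled through representatives. *)
Definition quot_ge0 L a : Prop := [set a + l | l in L] `&` poscone !=set0.

Definition quot_le L a b : Prop := quot_ge0 L (b - a).

Definition quot_unperforated L : Prop :=
  forall a (n : nat), (0 < n)%N -> quot_ge0 L (a *+ n) -> quot_ge0 L a.

Definition good_subgroup L : Prop :=
  [/\ subgroup L, order_convex L, quot_unperforated L &
   forall b a, 0 <= b -> quot_le L 0 a -> quot_le L a b ->
     exists a', [/\ L (a - a'), 0 <= a' & a' <= b]].

End POGroupDefs.
Arguments poscone {G}.

(* Order ideals as partially ordered groups, with the relative ordering. *)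
Record orderIdeal (G : pogroupType) := OrderIdeal {
  ideal_set : set G;
  ideal_setP : order_ideal ideal_set
}.

Definition ideal_sort (G : pogroupType) (I : orderIdeal G) : Type :=
  set_type (ideal_set I).
Coercion ideal_sort : orderIdeal >-> Sortclass.

Section IdealGroup.
Variables (G : pogroupType) (I : orderIdeal G).

Lemma ideal_zmod_closed : zmod_closed (mem (ideal_set I)).
Proof. by case: (ideal_setP I). Qed.

HB.instance Definition _ := SubChoice.on (ideal_sort I).
HB.instance Definition _ :=
  GRing.SubChoice_isSubZmodule.Build G _ (ideal_sort I) ideal_zmod_closed.
HB.instance Definition _ :=
  Order.SubChoice_isSubPOrder.Build _ G _ ring_display (ideal_sort I).

Lemma ideal_leD (x y z : ideal_sort I) : x <= y -> x + z <= y + z.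
Proof. by rewrite -!Order.le_val !raddfD; exact: pogroup_leD. Qed.

HB.instance Definition _ :=
  POrderedZmodule_isPOGroup.Build (ideal_sort I) ideal_leD.
End IdealGroup.

Section Traces.
Variables (R : realType) (G : pogroupType).
Implicit Types (Y : set (G -> R)) (s t : G -> R) (g u w : G).

Definition is_trace t : Prop :=
  [/\ zmod_morphism t, forall g, 0 <= g -> 0 <= t g & exists g, t g != 0].

(* S(G, u), as a subset of the space of all functions G -> R. *)
Definition traces u : set (G -> R) := [set t | is_trace t /\ t u = 1].

Definition hat g : (G -> R) -> R := fun t => t g.

(* convex sets and convex combinations in the real vector space of all
   functions G -> R *)
Definition trace_convex Y : Prop :=
  @convex_set R (G -> R^o) Y.

Definition trace_conv (l : {i01 R}) s t : G -> R :=
  (s : convex_lmodType (G -> R^o)) <| l |> (t : convex_lmodType (G -> R^o)).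

(* the point-open topology is the topology of pointwise convergence *)
Definition trace_compact Y : Prop := compact (Y : set {ptws G -> R}).

(* [Aff u f]: the restriction of [f] to S(G, u) is in Aff S(G, u) (values of
   [f] outside S(G, u) are irrelevant). *)
Definition Aff u (f : (G -> R) -> R) : Prop :=
  {within (traces u : set {ptws G -> R}), continuous f} /\
  forall s t (l : {i01 R}), traces u s -> traces u t ->
    f (trace_conv l s t) = l%:num * f s + (1 - l%:num) * f t.

(* density for the sup norm on Aff S(G, u) *)
Definition approximately_divisible u : Prop :=
  forall f, Aff u f -> forall e : R, 0 < e ->
    exists g, forall t, traces u t -> `|f t - hat g t| < e.

Definition ker1 t : set G := [set g | t g = 0].

Definition ker Y : set G := \bigcap_(s in Y) ker1 s.

Definition zeros u (W : set G) : set (G -> R) :=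
  [set s | traces u s /\ forall w, W w -> s w = 0].

Definition good_subset u Y : Prop :=
  Y = zeros u (ker Y) /\ good_subgroup (ker Y).

Definition face u Y : Prop :=
  [/\ Y `<=` traces u, trace_convex Y &
   forall s t (l : {i01 R}), traces u s -> traces u t ->
     0 < l%:num -> l%:num < 1 -> Y (trace_conv l s t) -> Y s /\ Y t].

(* f << g on Y *)
Definition llt_on Y (f h : (G -> R) -> R) : Prop :=
  exists2 e : R, 0 < e & forall s, Y s -> e <= h s - f s.

Definition order_unit_good u Y : Prop :=
  [/\ Y `<=` traces u, trace_compact Y, trace_convex Y &
   forall b a, order_unit b ->
     llt_on Y (fun=> 0) (hat a) -> llt_on Y (hat a) (hat b) ->
     exists a', [/\ forall s, Y s -> hat a' s = hat a s, 0 <= a' & a' <= b]].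

(* Only meaningful when [s] does not vanish at [w]. *)
Definition ideal_phi (I : orderIdeal G) (w : I) (s : G -> R) : I -> R :=
  fun x => s (val x) / s (val w).

End Traces.

Definition nearly_divisible (R : realType) (G : pogroupType) : Prop :=
  forall (I : orderIdeal G) (w : I),
    order_unit w -> approximately_divisible R w.

(* Main.v *)
(* Everything rests on comparing [G / ker Y] with the traces in [Y].  If the
   quotient is unperforated, an element that is strictly positive on [Y] is
   nonnegative modulo [ker Y] (Goodearl-Handelman), and goodness then lifts
   it into the required order interval; this gives (a) and (b).  Conversely, a
   nonzero element of the positive cone is positive at every point of [Y] by
   faithfulness, and (b) for the ideal that it generates bounds it below
   uniformly on [Y] relative to any other element.  Hence (b) moves [a] into
   the ideal generated by [b], where (a) lifts it.  Taking [b] a multiple of [u]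
   in the same argument shows that [G / ker Y] is unperforated. *)
Require Import Defs.
From mathcomp Require Import all_boot all_order all_algebra.
From mathcomp Require Import all_classical all_reals all_analysis.

Set Implicit Arguments.
Unset Strict Implicit.
Unset Printing Implicit Defensive.

Import Order.TTheory GRing.Theory Num.Theory.
Import numFieldNormedType.Exports.
Local Open Scope classical_set_scope.
Local Open Scope ring_scope.

(** * Partially ordered groups, their subgroups and principal order ideals *)

Section POGroupTheory.
Variable G : pogroupType.
Implicit Types (L : set G) (x y z a b u : G).

Lemma pog_subr_ge0 x y : (0 <= y - x) = (x <= y).
Proof.
apply/idP/idP => [/(pogroup_leD _ _ x)|/(pogroup_leD _ _ (- x))].
  by rewrite add0r subrK.
by rewrite subrr.
Qed.

Lemma pog_addr_ge0 x y : 0 <= x -> 0 <= y -> 0 <= x + y.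
Proof.
by move=> x0 y0; apply: (le_trans y0); rewrite -pog_subr_ge0 addrK.
Qed.

Lemma pog_mulrn_ge0 x n : 0 <= x -> 0 <= x *+ n.
Proof.
by move=> x0; elim: n => [|n IH]; rewrite ?mulr0n // mulrS pog_addr_ge0.
Qed.

Lemma pog_lerD x y z t : x <= y -> z <= t -> x + z <= y + t.
Proof.
rewrite -!(pog_subr_ge0 x) -(pog_subr_ge0 z) -(pog_subr_ge0 (x + z)) => xy zt.
by rewrite opprD addrACA pog_addr_ge0.
Qed.

Lemma pog_lerMn x m n : 0 <= x -> (m <= n)%N -> x *+ m <= x *+ n.
Proof. by move=> x0 mn; rewrite -pog_subr_ge0 -mulrnBr // pog_mulrn_ge0. Qed.

Lemma pog_lerN2 x y : (- x <= - y) = (y <= x).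
Proof. by rewrite -[LHS]pog_subr_ge0 opprK addrC pog_subr_ge0. Qed.

Lemma pog_lerNl x y : (- x <= y) = (- y <= x).
Proof. by rewrite -[y in LHS]opprK pog_lerN2. Qed.

Lemma quot_ge0P L a : quot_ge0 L a <-> exists2 l, L l & 0 <= a + l.
Proof.
split=> [[_ [[l Ll <-] al]]|[l Ll al]]; first by exists l.
by exists (a + l); split=> //; exists l.
Qed.

Lemma subgroupP L : subgroup L <-> L 0 /\ forall x y, L x -> L y -> L (x - y).
Proof.
split=> [[L0 LB]|[L0 LB]]; split.
- by rewrite inE in L0.
- by move=> x y Lx Ly; have := LB x y; rewrite !inE; apply.
- by rewrite inE.
- by move=> x y; rewrite !inE; exact: LB.
Qed.

Lemma subgroupN L x : subgroup L -> L x -> L (- x).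
Proof. by move=> /subgroupP[L0 LB] Lx; rewrite -[- x]add0r; exact: LB. Qed.

Lemma subgroupD L x y : subgroup L -> L x -> L y -> L (x + y).
Proof.
move=> sL Lx Ly; rewrite -[y]opprK.
by have /subgroupP[_ LB] := sL; apply: LB => //; exact: subgroupN.
Qed.

Definition principal_ideal b : set G :=
  [set x | exists n : nat, - (b *+ n) <= x /\ x <= b *+ n].

Lemma principal_idealP b : 0 <= b -> order_ideal (principal_ideal b).
Proof.
move=> b0; split.
- apply/subgroupP; split; first by exists 0%N; rewrite mulr0n oppr0.
  move=> x y [m [mx xm]] [n [ny yn]]; exists (m + n)%N.
  rewrite mulrnDr opprD; split; apply: pog_lerD => //.
    by rewrite pog_lerN2.
  by rewrite pog_lerNl.
- move=> x y z [m [mx _]] [n [_ zn]] xy yz; exists (m + n)%N; split.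
    apply: le_trans xy; apply: le_trans mx.
    by rewrite pog_lerN2; apply: pog_lerMn => //; exact: leq_addr.
  apply: (le_trans yz); apply: (le_trans zn).
  by apply: pog_lerMn => //; exact: leq_addl.
- move=> x y [m [mx xm]] [n [ny yn]]; exists (b *+ (m + n)); split.
  + exists (m + n)%N; split=> //; apply: (@le_trans _ _ 0).
      by rewrite pog_lerNl oppr0 pog_mulrn_ge0.
    exact: pog_mulrn_ge0.
  + by apply: (le_trans xm); apply: pog_lerMn => //; exact: leq_addr.
  + by apply: (le_trans yn); apply: pog_lerMn => //; exact: leq_addl.
Qed.

Lemma principal_ideal_id b : 0 <= b -> principal_ideal b b.
Proof.
move=> b0; exists 1%N; rewrite mulr1n; split=> //.
by rewrite -pog_subr_ge0 opprK pog_addr_ge0.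
Qed.

Lemma principal_ideal_neq0 b : 0 <= b -> b <> 0 ->
  principal_ideal b <> [set 0].
Proof.
by move=> b0 bN0 bE; apply: bN0; have := principal_ideal_id b0; rewrite bE.
Qed.

Lemma directedE x : directed_set [set: G] ->
  exists y z, [/\ 0 <= y, 0 <= z & x = y - z].
Proof.
move=> /(_ x 0 I I)[z [_ xz z0]]; exists z, (z - x).
by rewrite pog_subr_ge0 opprB addrC subrK.
Qed.

End POGroupTheory.

(** * Extension of cones to total preorders, and positivity in quotients *)

Section ConeTheory.
Variables (R : realType) (G : pogroupType).
Implicit Types (L Q : set G) (x y z a b u g h : G).

(** Encodes a translation-invariant preorder refining the order of [G] by its set of nonnegative
    elements; [Q] and its negative may overlap beyond 0. *)
Definition cone Q : Prop :=
  poscone `<=` Q /\ forall x y, Q x -> Q y -> Q (x + y).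

Lemma cone0 Q : cone Q -> Q 0.
Proof. by move=> [+ _]; apply; exact: lexx. Qed.

Lemma coneMn Q x n : cone Q -> Q x -> Q (x *+ n).
Proof.
move=> cQ Qx; elim: n => [|n IH]; first by rewrite mulr0n; exact: cone0.
by rewrite mulrS; case: cQ => _; apply.
Qed.

(* [- u *+ n.+1 + u *+ n = - u], so excluding [- u] excludes its multiples. *)
Lemma cone_properMn Q u n : cone Q -> 0 <= u -> ~ Q (- u) ->
  Q (- (u *+ n)) -> n = 0%N.
Proof.
case: n => // n cQ u0 + Qn; case.
have -> : - u = - (u *+ n.+1) + u *+ n by rewrite mulrS opprD subrK.
by case: (cQ) => Q0 QD; apply: QD => //; apply: Q0; exact: pog_mulrn_ge0.
Qed.

(** Zorn's lemma on the cones that contain [C] and avoid [- u]. If a maximal one omitted [g] and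
    [- g], adjoining either would produce [- u]; eliminating [g] from the two relations puts
    [- (u *+ (n + m))] in [Q], so [n = m = 0] and [- u] was already there. *)
Lemma maximal_cone (C : set G) u : 0 <= u -> cone C -> ~ C (- u) ->
  exists Q, [/\ C `<=` Q, cone Q, ~ Q (- u) & forall g, Q g \/ Q (- g)].
Proof.
move=> u0 cC uC.
pose P (X : set G) := X = set0 \/ [/\ C `<=` X, cone X & ~ X (- u)].
have [|Q [PQ maxQ]] := @Zorn_bigcup G P.
  move=> F FP Ftot.
  have [[X FX /set0P/eqP X0]|noX] := pselect (exists2 X, F X & X !=set0);
    last first.
    left; rewrite -subset0 => x [X FX Xx]; apply: noX.
    by exists X => //; exists x.
  have memP Z x : F Z -> Z x -> [/\ C `<=` Z, cone Z & ~ Z (- u)].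
    by move=> FZ Zx; case: (FP _ FZ) => // Z0; rewrite Z0 in Zx.
  have [x Xx] : X !=set0 by apply/set0P/eqP.
  have [CX [X1 _] _] := memP _ _ FX Xx.
  right; split; first by move=> y Cy; exists X => //; exact: CX.
    split; first by move=> y y0; exists X => //; exact: X1.
    move=> y z [Z1 FZ1 Zy] [Z2 FZ2 Zz].
    have [Z12|Z21] := Ftot _ _ FZ1 FZ2.
      exists Z2 => //; have [_ [_ +] _] := memP _ _ FZ2 Zz; apply=> //.
      exact: Z12.
    exists Z1 => //; have [_ [_ +] _] := memP _ _ FZ1 Zy; apply=> //.
    exact: Z21.
  by move=> [Z FZ Zu]; have [_ _ /(_ Zu)] := memP _ _ FZ Zu.
have {PQ} [CQ cQ uQ] : [/\ C `<=` Q, cone Q & ~ Q (- u)].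
  case: PQ => // Q0; exfalso; apply: (maxQ C); last by right; split.
  rewrite Q0; split; first exact: sub0set.
  by move=> /(_ 0)/=; apply; exact: cone0.
exists Q; split=> //.
have Q0 := cone0 cQ.
have adjoin g : ~ Q g -> exists2 q, Q q & exists n, - u = q + g *+ n.
  move=> Qg; pose X := [set x | exists2 q, Q q & exists n, x = q + g *+ n].
  have QX : Q `<=` X.
    by move=> q Qq; exists q => //; exists 0%N; rewrite mulr0n addr0.
  apply: contrapT => /= nX; apply: (maxQ X).
    split=> // /(_ g); apply: contra_not Qg => h; apply: h.
    by exists 0 => //; exists 1%N; rewrite mulr1n add0r.
  right; split=> //; first exact: (subset_trans CQ).
  case: cQ => Q1 QD; split; first exact: (subset_trans Q1).
  move=> _ _ [p Qp [m ->]] [q Qq [n ->]]; exists (p + q); first exact: QD.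
  by exists (m + n)%N; rewrite mulrnDr addrACA.
move=> g; have [|/adjoin[p Qp [m pm]]] := pselect (Q g); first by left.
have [|/adjoin[q Qq [n qn]]] := pselect (Q (- g)); first by right.
(* [n] copies of the first relation plus [m] of the second eliminate [g]. *)
have /(cone_properMn cQ u0 uQ) : Q (- (u *+ (n + m))).
  have -> : - (u *+ (n + m)) = p *+ n + q *+ m.
    rewrite mulrnDr opprD -!mulNrn {1}pm qn !mulrnDl !mulNrn -!mulrnA.
    by rewrite (mulnC m) addrACA subrr addr0.
  by case: (cQ) => _ QD; apply: QD; exact: coneMn.
move=> /eqP; rewrite addn_eq0 => /andP[/eqP n0 /eqP m0].
by case: uQ; rewrite pm m0 mulr0n addr0.
Qed.

(** * The real-valued trace induced by a total cone *)

Section Hoelder.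
Variables (Q : set G) (u : G).
Hypotheses (cQ : cone Q) (uu : order_unit u) (uQ : ~ Q (- u)).
Hypothesis totQ : forall g, Q g \/ Q (- g).

(* The rationals [p / q] with [p u <= q g] in the total preorder of cone [Q]. *)
Let cut g : set R := [set x | exists (p : int) (q : nat),
  x = p%:~R / q.+1%:R /\ Q (g *+ q.+1 - u *~ p)].
Let tau g : R := sup (cut g).

Let u0 : 0 <= u. Proof. by case: uu. Qed.

Let QD x y : Q x -> Q y -> Q (x + y). Proof. by case: cQ => _; apply. Qed.
Let Qge0 x : 0 <= x -> Q x. Proof. by case: cQ => + _; apply. Qed.

Let Qint_ge0 (p : int) : Q (u *~ p) -> 0 <= p.
Proof.
case: p => // n; rewrite NegzE mulrNz -pmulrn.
by move=> /(cone_properMn cQ u0 uQ).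
Qed.

Let cut_le0 (x : R) : cut 0 x -> x <= 0.
Proof.
move=> [p [q [-> ]]]; rewrite mul0rn sub0r -mulrNz => /Qint_ge0.
by rewrite oppr_ge0 pmulr_lle0 ?invr_gt0 ?ltr0n// lerz0.
Qed.

Let cutD g h (x y : R) : cut g x -> cut h y -> cut (g + h) (x + y).
Proof.
move=> [p [q [-> Qg]]] [r [s [-> Qh]]].
(* Sum over the common denominator; the predecessor appears because [cut] records denominators minus
   one. *)
exists (p * s.+1 + r * q.+1)%R, (q.+1 * s.+1).-1; rewrite prednK ?muln_gt0//.
split; first by rewrite addf_div ?pnatr_eq0// intrD !intrM natrM.
have -> : (g + h) *+ (q.+1 * s.+1) - u *~ (p * s.+1 + r * q.+1) =
    (g *+ q.+1 - u *~ p) *+ s.+1 + (h *+ s.+1 - u *~ r) *+ q.+1.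
  rewrite !mulrnBl mulrnDl mulrzDr opprD addrACA -!mulrnA [(s.+1 * _)%N]mulnC.
  by rewrite !mulrzA -!pmulrn.
by apply: QD; exact: coneMn.
Qed.

Let cut_int g (p : int) : Q (g - u *~ p) -> cut g p%:~R.
Proof. by move=> Qg; exists p, 0%N; rewrite divr1 mulr1n. Qed.

Let cut_sup g : has_sup (cut g).
Proof.
have [_ /(_ g)[K [_ Kg gK]]] := uu; split.
  exists (- K%:Z)%:~R; apply: cut_int.
  by apply: Qge0; rewrite mulrNz -pmulrn pog_subr_ge0.
(* [- K] lies in the cut of [- g], so [x - K] lies in the cut of 0, whose elements are at most 0. *)
exists K%:R => x gx; rewrite -subr_le0; apply: cut_le0.
rewrite -(subrr g); apply: (cutD gx).
have -> : - K%:R = (- K%:Z)%:~R :> R by rewrite mulrNz.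
by apply: cut_int; apply: Qge0; rewrite mulrNz -pmulrn opprK addrC pog_subr_ge0.
Qed.

Let le_tau g (x : R) : cut g x -> x <= tau g.
Proof. exact: sup_upper_bound. Qed.

Let tau_superadditive g h : tau g + tau h <= tau (g + h).
Proof.
rewrite -lerBrDr; apply: ge_sup => [|x gx]; first by case: (cut_sup g).
rewrite lerBrDr addrC -lerBrDr; apply: ge_sup => [|y hy].
  by case: (cut_sup h).
by rewrite lerBrDr addrC; apply: le_tau; exact: cutD.
Qed.

Let tau_ge0 g : Q g -> 0 <= tau g.
Proof.
by move=> Qg; apply: le_tau; apply: (@cut_int _ 0); rewrite mulr0z subr0.
Qed.

(** Superadditivity gives one inequality. For the other, totality places any rational [r] in the cut
    of [g] or its negative in that of [- g], so none lies strictly between [tau g] and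
    [- tau (- g)]. *)
Let tauN g : tau (- g) = - tau g.
Proof.
apply/eqP; rewrite eq_le; apply/andP; split.
  rewrite -subr_le0 opprK; apply: le_trans (tau_superadditive _ _) _.
  by rewrite addNr; apply: ge_sup => [|x /cut_le0//]; case: (cut_sup 0).
rewrite leNgt; apply/negP; rewrite ltrNr => /rat_in_itvoo[r].
rewrite in_itv/= => /andP[gr rg].
have [q q_] : exists q : nat, denq r = q.+1%:Z.
  by case: (denq r) (denq_gt0 r) => // -[//|q] _; exists q.
have rE : ratr r = (numq r)%:~R / q.+1%:R :> R by rewrite /ratr q_.
have [Qr|Qr] := totQ (g *+ q.+1 - u *~ numq r).
  by move: gr; rewrite ltNge le_tau//; exists (numq r), q.
move: rg; rewrite ltrNr ltNge le_tau//; exists (- numq r), q.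
split; first by rewrite rE mulrNz mulNr.
by rewrite mulNrn mulrNz -opprD.
Qed.

(** Oddness turns the superadditivity of [tau] into additivity. *)
Lemma total_cone_trace :
  exists2 t : G -> R, traces u t & forall g, Q g -> 0 <= t g.
Proof.
exists tau => //; have tau1 : tau u = 1.
  apply/eqP; rewrite eq_le; apply/andP; split; last first.
    by apply: le_tau; apply: (@cut_int _ 1); rewrite subrr; exact: cone0.
  rewrite -lerN2 -tauN; apply: le_tau; apply: (@cut_int _ (-1)).
  by rewrite mulrNz mulr1z opprK addNr; exact: cone0.
split=> //; split; last by exists u; rewrite tau1 oner_eq0.
- move=> g h; apply/eqP; rewrite eq_le; apply/andP; split; last first.
    by rewrite -tauN; exact: tau_superadditive.
  by rewrite lerBrDr; apply: le_trans (tau_superadditive _ _) _; rewrite subrK.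
- by move=> g g0; apply: tau_ge0; exact: Qge0.
Qed.

End Hoelder.

(* Goodearl-Handelman: an element failing to be nonnegative in [G / L] is
   nonpositive for some total preorder, hence for the trace that it induces. *)
Lemma quot_ge0_trace_gt0 L u a : subgroup L -> order_convex L ->
  quot_unperforated L -> order_unit u ->
  (forall t : G -> R, zeros u L t -> 0 < t a) -> quot_ge0 L a.
Proof.
move=> sL cL uL uu posa; apply: contrapT => na.
have [u0 uK] := uu; have /subgroupP[L0 LB] := sL.
(* Generated by the positive cone, [L] and [- a]: a preorder containing it identifies [L] with 0 and
   makes [a] nonpositive. *)
pose C := [set x | exists p l n, [/\ 0 <= p, L l & x = p + l - a *+ n]].
have memC p l n : 0 <= p -> L l -> C (p + l - a *+ n) by exists p, l, n.
have cC : cone C.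
  split=> [p p0|_ _ [p [l [m [p0 Ll ->]]]] [q [k [n [q0 Lk ->]]]]].
    by rewrite -[p]addr0 -[p + 0]subr0 -(mulr0n a); exact: memC.
  rewrite addrACA -opprD -mulrnDr addrACA; apply: memC.
    exact: pog_addr_ge0.
  exact: subgroupD.
(* Without copies of [a], convexity puts [u] in [L], so [L] is all of [G]. Otherwise a positive
   multiple of [a] dominates [u] modulo [L], and unperforation makes [a] nonnegative there. *)
have nCu : ~ C (- u).
  move=> [p [l [[|n] [p0 Ll ue]]]].
    have Lu : L u.
      apply: (cL _ _ (- l) L0 _ u0); first exact: subgroupN.
      rewrite -pog_subr_ge0; suff -> : - l - u = p by [].
      by rewrite ue mulr0n subr0 addrC addrK.
    apply: na; apply/quot_ge0P; exists (- a); last by rewrite subrr.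
    have [K [_ Ka aK]] := uK a; have LuK : L (u *+ K).
      by elim: (K) => [|k IH]; rewrite ?mulr0n// mulrS; exact: subgroupD.
    by apply: subgroupN => //; apply: (cL _ _ _ _ LuK Ka aK); exact: subgroupN.
  apply: na; apply: (uL _ n.+1) => //; apply/quot_ge0P; exists (- l).
    exact: subgroupN.
  suff -> : a *+ n.+1 - l = p + u by exact: pog_addr_ge0.
  by rewrite -[u]opprK ue opprB addrCA opprD addNKr.
have [Q [CQ cQ uQ totQ]] := maximal_cone u0 cC nCu.
have [t tu t0] := total_cone_trace cQ uu uQ totQ.
have [[tB _ _] _] := tu.
have t00 : t 0 = 0 by have := tB 0 0; rewrite !subrr.
have tN g : t (- g) = - t g by rewrite -[- g]sub0r tB t00 sub0r.
have : 0 < t a.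
  apply: posa; split=> // l Ll; apply/eqP; rewrite eq_le; apply/andP; split.
    rewrite -oppr_ge0 -tN; apply: t0; apply: CQ.
    rewrite -[- l]add0r -[_ - l]subr0 -(mulr0n a); apply: memC => //.
    exact: subgroupN.
  apply: t0; apply: CQ.
  by rewrite -[l]add0r -[_ + l]subr0 -(mulr0n a); exact: memC.
rewrite ltNge -oppr_ge0 -tN t0//; apply: CQ.
by rewrite -[- a]add0r -[in X in X - _](addr0 0) -(mulr1n a); exact: memC.
Qed.

End ConeTheory.

(** * Arithmetic of traces and kernels; compactness of zero sets *)

Section TraceTheory.
Variables (R : realType) (G : pogroupType).
Implicit Types (L : set G) (Y : set (G -> R)) (x y a b u g h : G).
Implicit Types (s t : G -> R) (I : orderIdeal G).

Lemma traceB u t x y : traces u t -> t (x - y) = t x - t y.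
Proof. by move=> [[tB _ _] _]; exact: tB. Qed.

Lemma trace0 u t : traces u t -> t 0 = 0.
Proof. by move=> tu; rewrite -(subrr 0) (traceB _ _ tu) subrr. Qed.

Lemma traceN u t x : traces u t -> t (- x) = - t x.
Proof. by move=> tu; rewrite -sub0r (traceB _ _ tu) (trace0 tu) sub0r. Qed.

Lemma traceD u t x y : traces u t -> t (x + y) = t x + t y.
Proof.
by move=> tu; rewrite -[y in LHS]opprK (traceB _ _ tu) (traceN _ tu) opprK.
Qed.

Lemma traceMn u t x n : traces u t -> t (x *+ n) = t x *+ n.
Proof.
move=> tu; elim: n => [|n IH]; first by rewrite !mulr0n (trace0 tu).
by rewrite !mulrS (traceD _ _ tu) IH.
Qed.

Lemma trace_le u t x y : traces u t -> x <= y -> t x <= t y.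
Proof.
move=> tu xy; rewrite -subr_ge0 -(traceB _ _ tu).
by case: tu => [[_ + _] _]; apply; rewrite pog_subr_ge0.
Qed.

Lemma subgroup_ker u Y : Y `<=` traces u -> subgroup (ker Y).
Proof.
move=> Yu; apply/subgroupP; split; first by move=> t /Yu /trace0.
move=> x y kx ky t Yt; rewrite /ker1/= (traceB _ _ (Yu _ Yt)).
by have := kx _ Yt; have := ky _ Yt; rewrite /ker1/= => -> ->; rewrite subrr.
Qed.

Lemma order_convex_ker u Y : Y `<=` traces u -> order_convex (ker Y).
Proof.
move=> Yu x y z kx kz xy yz t Yt; have tu := Yu _ Yt.
apply/eqP; rewrite eq_le -{1}(kz _ Yt) -(kx _ Yt).
by rewrite !(trace_le tu).
Qed.

Lemma trace_kerD u Y t x k : Y `<=` traces u -> Y t -> ker Y k ->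
  t (x + k) = t x.
Proof.
by move=> Yu Yt kk; rewrite (traceD _ _ (Yu _ Yt)) (kk _ Yt) addr0.
Qed.

Lemma trace_gt0 u Y t p : Y `<=` traces u ->
  (forall s, Y s -> ker1 s `&` poscone = [set 0]) ->
  Y t -> 0 <= p -> p <> 0 -> 0 < t p.
Proof.
move=> Yu Yf Yt p0 pN0; rewrite lt_neqAle; apply/andP; split.
  apply/eqP => tp0; apply: pN0; have : (ker1 t `&` poscone) p by [].
  by rewrite Yf.
by rewrite -(trace0 (Yu _ Yt)) (trace_le (Yu _ Yt)).
Qed.

(** Tychonoff: the order unit bounds every trace at [g] by [K g], so the set lies in a product of
    segments, and its defining conditions are closed; [t u = 1] subsumes the open condition of being
    nonzero. *)
Lemma compact_zeros u L : order_unit u ->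
  trace_compact (zeros u L : set (G -> R)).
Proof.
move=> [u0 uK].
have /choice[K KP] : forall g, exists K : nat, - (u *+ K) <= g /\ g <= u *+ K.
  by move=> g; have [K [_ ? ?]] := uK g; exists K.
pose B : set {ptws G -> R} :=
  [set f | forall g, `[- (K g)%:R, (K g)%:R]%classic (f g)].
have Bcompact : compact B.
  apply: (@tychonoff G (fun=> R) (fun g => `[- (K g)%:R, (K g)%:R]%classic)).
  by move=> g; exact: segment_compact.
have ev g : continuous (fun f : {ptws G -> R} => f g).
  exact: (@proj_continuous G (fun=> R) g).
apply: (subclosed_compact _ Bcompact); last first.
  move=> t [tu _] g; rewrite /= in_itv/=; have [Kg gK] := KP g.
  have tK : t (u *+ K g) = (K g)%:R by rewrite (traceMn _ _ tu) (proj2 tu).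
  by rewrite -tK -(traceN _ tu) !(trace_le tu).
have -> : (zeros u L : set {ptws G -> R}) =
    (\bigcap_(z in [set: G * G])
      [set f | f (z.1 - z.2) - (f z.1 - f z.2) = 0]) `&`
    (\bigcap_(g in poscone) [set f | 0 <= f g]) `&`
    ([set f | f u = 1] `&` \bigcap_(l in L) [set f | f l = 0]).
  apply/seteqP; split=> t.
    move=> [[[tB t0 _] tu] tL]; do !split=> //.
    by move=> [x y] _ /=; rewrite tB subrr.
  move=> [[tB t0] [tu tL]]; do !split=> //.
    by move=> x y; apply/eqP; rewrite -subr_eq0; apply/eqP; exact: (tB (x, y)).
  by exists u; rewrite tu oner_eq0.
have cl0 (c : R) (F : {ptws G -> R} -> R) :
    continuous F -> closed [set f | F f = c].
  by move=> cF; apply: (@preimage_closed _ _ F [set c]) => // f _; exact: cF.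
have cB (F H : {ptws G -> R} -> R) : continuous F -> continuous H ->
    continuous (fun f => F f - H f).
  by move=> cF cH f; exact: (cvgB (cF f) (cH f)).
do !apply: closedI.
- apply: closed_bigI => -[x y] _; apply: (cl0 0).
  exact: (cB _ _ (ev _) (cB _ _ (ev _) (ev _))).
- apply: closed_bigI => g _.
  apply: (@preimage_closed _ _ (fun f : {ptws G -> R} => f g) [set r | 0 <= r]).
    by move=> f _; exact: ev.
  exact: closed_ge.
- exact: cl0.
- by apply: closed_bigI => l _; exact: cl0.
Qed.

Lemma order_ideal_pos (L : set G) : order_ideal L -> L <> [set 0] ->
  exists p, [/\ L p, 0 <= p & p <> 0].
Proof.
move=> [sL cL dL] LN0; have /subgroupP[L0 _] := sL.
have [x Lx xN0] : exists2 x, L x & x <> 0.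
  apply: contrapT => nx; apply: LN0; apply/seteqP; split=> [x Lx|_ ->//].
  by apply: contrapT => xN0; apply: nx; exists x.
(* A majorant [z] of [x] and 0 is the witness unless it is 0, and then [- x] is. *)
have [z [Lz xz z0]] := dL _ _ Lx L0.
have [z_eq0|/eqP zN0] := eqVneq z 0; last by exists z.
exists (- x); split; first exact: subgroupN.
  by rewrite -[- x]sub0r pog_subr_ge0 -z_eq0.
by move=> /eqP; rewrite oppr_eq0 => /eqP.
Qed.

End TraceTheory.

(** * Normalised restrictions to order ideals, and lifting in both directions *)

Section IdealTraces.
Variables (R : realType) (G : pogroupType).
Implicit Types (L : set G) (Y : set (G -> R)) (x y a b u g h : G).
Implicit Types (s t : G -> R) (I : orderIdeal G).

Lemma ideal_val_le I (x y : I) : (x <= y) = (val x <= val y).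
Proof. exact: leEsub. Qed.

Lemma order_unit_val_neq0 I (w : I) : ideal_set I <> [set 0] ->
  order_unit w -> 0 <= val w /\ val w <> 0.
Proof.
move=> IN0 [w0 wK]; split; first by move: w0; rewrite ideal_val_le raddf0.
move=> vw0; apply: IN0; apply/seteqP; split=> [x Ix|_ ->]; last first.
  by have /subgroupP[] : subgroup (ideal_set I) by case: (ideal_setP I).
have w_eq0 : w = 0 by apply: val_inj; rewrite vw0 raddf0.
have [K [_]] := wK (SigSub (mem_set Ix)).
rewrite w_eq0 mul0rn oppr0 !ideal_val_le raddf0 /= => x0 x1.
by apply/eqP; rewrite eq_le x0 x1.
Qed.

Lemma traces_ideal_phi I (w : I) u t : traces u t -> 0 < t (val w) ->
  traces w (ideal_phi w t).
Proof.
move=> tu tw; have w1 : ideal_phi w t w = 1.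
  by rewrite /ideal_phi divff// gt_eqF.
split=> //; split; last by exists w; rewrite w1 oner_eq0.
  by move=> x y; rewrite /ideal_phi raddfB (traceB _ _ tu) mulrBl.
move=> x; rewrite ideal_val_le raddf0 => x0; apply: divr_ge0; last exact: ltW.
by rewrite -(trace0 tu) (trace_le tu).
Qed.

(** Each coordinate of the map is a quotient of two evaluations, continuous where the denominator is
    nonzero, and the pointwise topology is initial for the coordinates. *)
Lemma compact_ideal_phi I (w : I) Y : trace_compact Y ->
  (forall t, Y t -> t (val w) != 0) -> trace_compact (ideal_phi w @` Y).
Proof.
move=> cY YN0.
apply: (@continuous_compact {ptws G -> R} {ptws I -> R} _ Y _ cY).
have ev g : continuous (fun f : {ptws G -> R} => f g).
  exact: (@proj_continuous G (fun=> R) g).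
have phix (x : I) : {within (Y : set {ptws G -> R}),
    continuous (fun t => ideal_phi w t x : R)}.
  apply: continuous_in_subspaceT => t /set_mem Yt.
  exact: (cvgM (ev _ t) (cvgV (YN0 _ Yt) (ev _ t))).
move=> t; apply/cvg_sup => x.
exact: (@continuous_comp_initial _ (subspace (Y : set {ptws G -> R})) R
  (fun f : {ptws I -> R} => f x) (ideal_phi w) (phix x) t).
Qed.

Lemma zeros_comb u L s t (c d : R) : zeros u L s -> zeros u L t ->
  0 <= c -> 0 <= d -> 0 < c + d ->
  zeros u L (fun g => (c * s g + d * t g) / (c + d)).
Proof.
move=> [su sL] [tu tL] c0 d0 cd0.
have cdu : (c * s u + d * t u) / (c + d) = 1.
  by rewrite (proj2 su) (proj2 tu) !mulr1 divff// gt_eqF.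
split; last by move=> l Ll; rewrite sL// tL// !mulr0 addr0 mul0r.
split=> //; split; last by exists u; rewrite cdu oner_eq0.
  move=> x y; rewrite (traceB _ _ su) (traceB _ _ tu) -mulrBl.
  by rewrite !mulrBr opprD addrACA.
move=> g g0; apply: divr_ge0; last exact: ltW.
have sg : 0 <= s g by rewrite -(trace0 su) (trace_le su).
have tg : 0 <= t g by rewrite -(trace0 tu) (trace_le tu).
by apply: addr_ge0; exact: mulr_ge0.
Qed.

(** [ideal_phi w] is projective rather than affine, since its normalisation distorts the weights.
    Dividing each weight by the value at [w] compensates for this, and [zeros_comb] renormalises at
    [u]. *)
Lemma convex_ideal_phi I (w : I) u L :
  (forall t : G -> R, zeros u L t -> 0 < t (val w)) ->
  trace_convex (ideal_phi w @` (zeros u L : set (G -> R))).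
Proof.
move=> pw f h l /set_mem[s Ls <-] /set_mem[t Lt <-]; apply/mem_set.
have [sw tw] := (pw _ Ls, pw _ Lt).
have [l0 l1] : 0 <= l%:num /\ 0 <= 1 - l%:num by rewrite subr_ge0.
set c := l%:num / s (val w); set d := (1 - l%:num) / t (val w).
have c0 : 0 <= c by apply: divr_ge0 => //; exact: ltW.
have d0 : 0 <= d by apply: divr_ge0 => //; exact: ltW.
have cd1 : c * s (val w) + d * t (val w) = 1.
  by rewrite !divfK ?gt_eqF// addrC subrK.
have cd0 : 0 < c + d.
  rewrite lt_neqAle addr_ge0// andbT eq_sym; apply/eqP => /eqP.
  rewrite paddr_eq0// => /andP[/eqP cE /eqP dE].
  by move: cd1; rewrite cE dE !mul0r addr0 => /eqP; rewrite eq_sym oner_eq0.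
exists (fun g => (c * s g + d * t g) / (c + d)); first exact: zeros_comb.
apply/funext => x; rewrite /ideal_phi cd1 div1r invrK divfK ?gt_eqF//.
by rewrite /c /d mulrAC [_ / t _ * _]mulrAC -!mulrA.
Qed.

(** The inverse of the evaluation is continuous on the compact [Y], hence bounded. *)
Lemma compact_evaluation_gt0 Y p : trace_compact Y ->
  (forall t, Y t -> 0 < t p) ->
  exists n : nat, forall t, Y t -> 1 < t p * n%:R.
Proof.
move=> cY pos; have ev : continuous (fun f : {ptws G -> R} => f p).
  exact: (@proj_continuous G (fun=> R) p).
have : compact ((fun t : {ptws G -> R} => (t p)^-1) @` Y).
  apply: (@continuous_compact {ptws G -> R} R _ Y _ cY).
  apply: continuous_in_subspaceT => t.
  move=> /set_mem Yt; exact: (cvgV (lt0r_neq0 (pos _ Yt)) (ev t)).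
move=> /compact_bounded[M [_ MP]].
exists (Num.bound `|M + 1|) => t Yt; have tp := pos _ Yt.
rewrite mulrC -ltr_pdivrMr// div1r.
apply: le_lt_trans (archi_boundP (normr_ge0 (M + 1))).
apply: le_trans (le_trans _ (ler_norm _)); first exact: ler_norm.
by apply: (MP (M + 1)); [rewrite ltrDl|exists t].
Qed.

(** The lift is made in [G], where strict positivity on [Y] gives nonnegativity modulo [ker Y];
    convexity of the ideal then brings the lift back into [I]. *)
Lemma good_subset_order_unit_good u Y I (w : I) : order_unit u ->
  good_subset u Y -> (forall s, Y s -> ker1 s `&` poscone = [set 0]) ->
  ideal_set I <> [set 0] -> order_unit w ->
  order_unit_good w (ideal_phi w @` Y).
Proof.
move=> uu [YE [sL cL uL gL]] Yf IN0 wu.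
have Yu : Y `<=` traces u by rewrite YE => t [].
have [w0 wN0] := order_unit_val_neq0 IN0 wu.
have Yw t : Y t -> 0 < t (val w) by move=> Yt; exact: (trace_gt0 Yu Yf).
have kerpos a : (forall t, Y t -> 0 < t a) -> quot_ge0 (ker Y) a.
  move=> posa; apply: (@quot_ge0_trace_gt0 R _ _ u) => // t Lt.
  by apply: posa; rewrite YE.
split.
- by move=> _ [t Yt <-]; apply: traces_ideal_phi; [exact: Yu|exact: Yw].
- apply: compact_ideal_phi; last by move=> t /Yw; exact: lt0r_neq0.
  by rewrite YE; exact: compact_zeros.
- by rewrite YE; apply: convex_ideal_phi => t; rewrite -YE; exact: Yw.
move=> b a [b0 _] [e e0 ea] [e' e'0 ab].
have b0v : 0 <= val b by move: b0; rewrite ideal_val_le raddf0.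
have [a' [La' a'0 a'b]] : exists a',
    [/\ ker Y (val a - a'), 0 <= a' & a' <= val b].
  apply: gL => //; apply: kerpos => t Yt.
    have := ea _ (ex_intro2 _ _ t Yt erefl); rewrite /hat /ideal_phi !subr0.
    by move=> /(lt_le_trans e0); rewrite pmulr_lgt0// invr_gt0 Yw.
  have := ab _ (ex_intro2 _ _ t Yt erefl); rewrite /hat /ideal_phi -mulrBl.
  move=> /(lt_le_trans e'0); rewrite pmulr_lgt0 ?invr_gt0 ?Yw//.
  by rewrite (traceB _ _ (Yu _ Yt)).
have Ia' : ideal_set I a'.
  have [sI cI _] := ideal_setP I; have /subgroupP[I0 _] := sI.
  by apply: (cI _ _ (val b) I0 _ a'0 a'b); exact: set_mem (valP b).
exists (SigSub (mem_set Ia')); split.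
- move=> _ [t Yt <-]; rewrite /hat /ideal_phi /=; congr (_ / _).
  apply/eqP; rewrite eq_sym -subr_eq0 -(traceB _ _ (Yu _ Yt)); apply/eqP.
  exact: La'.
- by rewrite ideal_val_le raddf0.
- by rewrite ideal_val_le.
Qed.

(** Directedness of [G] reduces to [y >= 0]. Modulo [ker Y], some multiple of a nonzero positive [p]
    of [L] dominates [y], and goodness lifts [y] into an interval that convexity keeps inside
    [L]. *)
Lemma good_subset_ideal_ker u Y L : directed_set [set: G] -> order_unit u ->
  good_subset u Y -> (forall s, Y s -> ker1 s `&` poscone = [set 0]) ->
  order_ideal L -> L <> [set 0] ->
  forall g, exists x k, [/\ L x, ker Y k & g = x + k].
Proof.
move=> dG uu [YE [sK cK uK gK]] Yf iL LN0 g.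
have Yu : Y `<=` traces u by rewrite YE => t [].
have [p [Lp p0 pN0]] := order_ideal_pos iL LN0.
have [sL cL _] := iL; have /subgroupP[L0 _] := sL.
have LpK n : L (p *+ n).
  by elim: n => [|n IH]; rewrite ?mulr0n// mulrS; exact: subgroupD.
have pos y : 0 <= y -> exists2 x, L x & ker Y (y - x).
  move=> y0; have [_ /(_ y)[K [K0 _ yK]]] := uu.
  have [n np] : exists n : nat, forall t, Y t -> 1 < t p * n%:R.
    have cY : trace_compact Y by rewrite YE; exact: compact_zeros.
    exact: (compact_evaluation_gt0 cY (fun t Yt => trace_gt0 Yu Yf Yt p0 pN0)).
  (* On [Y], [y] is at most [K] while [p *+ n] exceeds 1, so [n * K] copies of [p] strictly exceed
     [y]. *)
  have : quot_ge0 (ker Y) (p *+ (n * K) - y).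
    apply: (@quot_ge0_trace_gt0 R _ _ u) => // t; rewrite -YE => Yt.
    have tu := Yu _ Yt; rewrite (traceB _ _ tu) subr_gt0.
    apply: (le_lt_trans (trace_le tu yK)).
    rewrite !(traceMn _ _ tu) (proj2 tu) mulrnA ltrMn2r.
    by rewrite -mulr_natr np// K0.
  move=> pyK.
  have [|x [kx x0 xp]] := gK (p *+ (n * K)) y (pog_mulrn_ge0 _ p0) _ pyK.
    apply/quot_ge0P; exists 0; last by rewrite subr0 addr0.
    by have /subgroupP[] := sK.
  by exists x => //; exact: (cL _ _ _ L0 (LpK (n * K)%N)).
have [y [z [/pos[x Lx kx] /pos[x' Lx' kx'] ->]]] := directedE g dG.
exists (x - x'), ((y - x) - (z - x')); split.
- by have /subgroupP[_] := sL; apply.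
- by have /subgroupP[_] := sK; apply.
- by rewrite addrACA [x + _]addrC subrK -opprD [x' + _]addrC subrK.
Qed.

Lemma cover_ideal_bound u Y p g : Y `<=` traces u -> 0 <= p ->
  [set x + k | x in principal_ideal p & k in ker Y] =
  [set x + k | x in [set: G] & k in ker Y] ->
  exists n : nat, forall t, Y t -> t g <= t p *+ n.
Proof.
move=> Yu p0 pE.
have : [set x + k | x in [set: G] & k in ker Y] g.
  exists g => //; exists 0; last by rewrite addr0.
  by have /subgroupP[] := subgroup_ker Yu.
rewrite -pE => -[x [n [_ xn]] [k kk <-]]; exists n => t Yt.
rewrite (trace_kerD _ Yu Yt kk) -(traceMn _ _ (Yu _ Yt)).
exact: (trace_le (Yu _ Yt)).
Qed.

(* Faithfulness gives positivity at each point of [Y]; the covering condition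
   makes it uniform, so that no compactness is needed. *)
Lemma cover_ideal_phi_gt0 u Y I (w a : I) c p : Y `<=` traces u ->
  (forall s, Y s -> ker1 s `&` poscone = [set 0]) ->
  (forall t, Y t -> 0 < t (val w)) -> 0 <= p -> p <> 0 ->
  [set x + k | x in principal_ideal p & k in ker Y] =
  [set x + k | x in [set: G] & k in ker Y] ->
  (forall t, Y t -> t (val a) *+ c = t p) ->
  exists2 e : R, 0 < e & forall f, (ideal_phi w @` Y) f -> e <= f a.
Proof.
move=> Yu Yf Yw p0 pN0 pE ap.
have [n wn] := cover_ideal_bound (val w) Yu p0 pE.
(* On [Y], [w] is at most [p *+ n], which takes the values of [a *+ (c * n)]; the successor keeps
   the inverse positive even when [n] is 0. *)
exists (c * n).+1%:R^-1; first by rewrite invr_gt0.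
move=> _ [t Yt <-]; rewrite /ideal_phi ler_pdivlMr ?Yw// mulrC.
rewrite ler_pdivrMr ?ltr0n// mulr_natr.
apply: le_trans (wn _ Yt) _; rewrite -ap// -mulrnA; apply: ler_wpMn2l => //.
have := trace_gt0 Yu Yf Yt p0 pN0; rewrite -ap// => tac.
apply: ltW; move: tac.
by case: (c) => [|m]; rewrite ?mulr0n ?ltxx ?pmulrn_lgt0.
Qed.

Lemma principal_order_unit b (b0 : 0 <= b) :
  order_unit (SigSub (mem_set (principal_ideal_id b0)) :
    OrderIdeal (principal_idealP b0)).
Proof.
split; first by rewrite ideal_val_le raddf0.
move=> g; have [n [ng gn]] := set_mem (valP g); exists n.+1; split=> //.
  rewrite ideal_val_le raddfN raddfMn/=; apply: le_trans ng.
  by rewrite pog_lerN2; exact: pog_lerMn.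
rewrite ideal_val_le raddfMn/=; apply: le_trans gn _; exact: pog_lerMn.
Qed.

(** The common core of unperforation and interval lifting. [p] and [q] are nonzero positive
    representatives, modulo [ker Y], of a multiple of [a] and of [b - a]; they supply the uniform
    strict inequalities that order unit goodness asks for in the ideal generated by [b]. The
    multiple [c] serves unperforation. *)
Lemma order_unit_good_lift u Y b a c p q : Y `<=` traces u ->
  (forall s, Y s -> ker1 s `&` poscone = [set 0]) ->
  (forall I, ideal_set I <> [set 0] ->
     forall w : I, order_unit w -> order_unit_good w (ideal_phi w @` Y)) ->
  (forall I, ideal_set I <> [set 0] ->
     [set x + k | x in ideal_set I & k in ker Y] =
     [set x + k | x in [set: G] & k in ker Y]) ->
  0 <= b -> principal_ideal b a ->
  0 <= p -> p <> 0 -> ker Y (p - a *+ c) ->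
  0 <= q -> q <> 0 -> ker Y (q - (b - a)) ->
  exists a', [/\ ker Y (a - a'), 0 <= a' & a' <= b].
Proof.
move=> Yu Yf oug cov b0 ba p0 pN0 pa q0 qN0 qba.
have kerE x y t : ker Y (x - y) -> Y t -> t y = t x.
  by move=> kxy Yt; rewrite -[x](subrK y) addrC (trace_kerD _ Yu Yt kxy).
have ap t : Y t -> t a *+ c = t p.
  by move=> Yt; rewrite -(traceMn _ _ (Yu _ Yt)); exact: kerE.
have bq t : Y t -> t b - t a = t q.
  by move=> Yt; rewrite -(traceB _ _ (Yu _ Yt)); exact: kerE.
have a_gt0 t : Y t -> 0 < t a.
  move=> Yt; have := trace_gt0 Yu Yf Yt p0 pN0; rewrite -ap//.
  by case: (c) => [|m]; rewrite ?mulr0n ?ltxx ?pmulrn_lgt0.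
have Yb t : Y t -> 0 < t b.
  move=> Yt; apply: lt_trans (a_gt0 _ Yt) _; rewrite -subr_gt0 bq//.
  exact: (trace_gt0 Yu Yf).
(* If [b] is 0, its positivity on [Y] leaves [Y] empty, so [ker Y] is everything. *)
have [b_eq0|/eqP bN0] := eqVneq b 0.
  exists 0; split=> // t Yt; have := Yb _ Yt.
  by rewrite b_eq0 (trace0 (Yu _ Yt)) ltxx.
have bu := principal_order_unit b0.
pose w : OrderIdeal (principal_idealP b0) :=
  SigSub (mem_set (principal_ideal_id b0)).
pose a1 : OrderIdeal (principal_idealP b0) := SigSub (mem_set ba).
have [e e0 ea] := @cover_ideal_phi_gt0 u Y _ w a1 c p Yu Yf Yb p0 pN0
  (cov (OrderIdeal (principal_idealP p0)) (principal_ideal_neq0 p0 pN0)) ap.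
have [e' e'0 eba] := @cover_ideal_phi_gt0 u Y _ w (w - a1) 1 q Yu Yf Yb q0 qN0
  (cov (OrderIdeal (principal_idealP q0)) (principal_ideal_neq0 q0 qN0))
  (fun t Yt => etrans (traceB _ _ (Yu _ Yt)) (bq t Yt)).
have [_ _ _ gw] := oug (OrderIdeal (principal_idealP b0))
  (principal_ideal_neq0 b0 bN0) w bu.
have [||a' [a'a a'0 a'b]] := gw w a1 bu.
- by exists e => // s /ea; rewrite /hat subr0.
- exists e' => // _ [t Yt <-]; have := eba _ (ex_intro2 _ _ t Yt erefl).
  by rewrite /hat /ideal_phi raddfB (traceB _ _ (Yu _ Yt)) mulrBl.
exists (val a'); split; [|by rewrite ideal_val_le raddf0 in a'0
  |by rewrite ideal_val_le in a'b].
move=> t Yt; rewrite /ker1/= (traceB _ _ (Yu _ Yt)).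
have := a'a _ (ex_intro2 _ _ t Yt erefl); rewrite /hat /ideal_phi.
by move=> /mulIf ->; rewrite ?subrr// invr_neq0// gt_eqF// Yb.
Qed.

End IdealTraces.

Theorem proposition6p8 (R : realType) (G : pogroupType) (u : G)
    (Y : set (G -> R)) :
  dimension_group G -> order_unit u -> nearly_divisible R G ->
  Y `<=` traces u -> Y = zeros u (ker Y) ->
  (forall s, Y s -> ker1 s `&` poscone = [set 0]) ->
  face u Y \/ quot_unperforated (ker Y) ->
  good_subset u Y <->
  (forall I : orderIdeal G, ideal_set I <> [set 0] ->
     forall w : I, order_unit w -> order_unit_good w (ideal_phi w @` Y)) /\
  (forall I : orderIdeal G, ideal_set I <> [set 0] ->
     [set x + k | x in ideal_set I & k in ker Y] =
     [set x + k | x in [set: G] & k in ker Y]).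
Proof.
move=> [dG _ _] uu _ Yu YE Yf _; split=> [gY|[oug cov]].
  split=> I IN0; first by move=> w; exact: (good_subset_order_unit_good uu).
  apply/seteqP; split=> [_ [x _ [k kk <-]]|g _].
    by exists x => //; exists k.
  have [x [k [Ix kk ->]]] :=
    good_subset_ideal_ker dG uu gY Yf (ideal_setP I) IN0 g.
  by exists x => //; exists k.
have sK := subgroup_ker Yu; have /subgroupP[K0 KB] := sK.
have cK := order_convex_ker Yu.
split=> //; split=> //.
- move=> a n n0 /quot_ge0P[k kk ak0]; apply/quot_ge0P.
  (* A zero representative gives [t a *+ n = 0] on [Y], so [a] lies in the kernel. *)
  have [ak|/eqP akN0] := eqVneq (a *+ n + k) 0.
    exists (- a); last by rewrite subrr.
    apply: (subgroupN sK) => t Yt; have tu := Yu _ Yt.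
    have : t (a *+ n + k) = 0 by rewrite ak (trace0 tu).
    rewrite (trace_kerD _ Yu Yt kk) (traceMn _ _ tu).
    by move=> /eqP; rewrite mulrn_eq0 (gtn_eqF n0) => /eqP.
  have [u0 /(_ a)[K [_ Ka aK]]] := uu.
  (* The lift needs [u *+ K - a] nonzero; otherwise [a] is itself a multiple of [u]. *)
  have [aE|/eqP baN0] := eqVneq (u *+ K - a) 0.
    exists 0 => //; rewrite addr0; move/eqP: aE; rewrite subr_eq0 => /eqP <-.
    exact: pog_mulrn_ge0.
  have ba : principal_ideal (u *+ K) a by exists 1%N; rewrite mulr1n.
  have pa : ker Y (a *+ n + k - a *+ n) by rewrite addrC addKr.
  have qba : ker Y (u *+ K - a - (u *+ K - a)) by rewrite subrr.
  have ba0 : 0 <= u *+ K - a by rewrite pog_subr_ge0.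
  have [a' [kaa' a'0 _]] := order_unit_good_lift Yu Yf oug cov
    (pog_mulrn_ge0 _ u0) ba ak0 akN0 pa ba0 baN0 qba.
  exists (a' - a); first by rewrite -opprB; exact: (subgroupN sK).
  by rewrite addrC subrK.
- move=> b a b0 /quot_ge0P[k kk]; rewrite subr0 => ak0 /quot_ge0P[l kl bal0].
  (* When the representative of [a] or of [b - a] is 0, the endpoint 0 or [b] is the lift. *)
  have [ak|/eqP akN0] := eqVneq (a + k) 0.
    exists 0; split=> //; rewrite subr0 -[a](addrK k) ak sub0r.
    exact: (subgroupN sK).
  have [bal|/eqP balN0] := eqVneq (b - a + l) 0.
    exists b; split=> //; rewrite -opprB; apply: (subgroupN sK).
    by rewrite -[b - a](addrK l) bal sub0r; exact: (subgroupN sK).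
  (* The covering condition concerns nonzero ideals only. For [b = 0], [a + k] lies between 0 and
     [k + l], and convexity of the kernel applies. *)
  have [b_eq0|/eqP bN0] := eqVneq b 0.
    exists 0; split=> //; rewrite subr0 -[a](addrK k); apply: KB => //.
    apply: (cK _ _ (a + k + (b - a + l)) K0 _ ak0).
      rewrite b_eq0 sub0r addrACA subrr add0r; exact: (subgroupD sK).
    by rewrite -pog_subr_ge0 addrAC subrr add0r.
  (* Covering by the ideal generated by [b] replaces [a] by a congruent [x] inside that ideal. *)
  have [x bx [m km xm]] : [set x + m | x in principal_ideal b & m in ker Y] a.
    rewrite (cov (OrderIdeal (principal_idealP b0))
      (principal_ideal_neq0 b0 bN0)).
    by exists a => //; exists 0 => //; rewrite addr0.
  have aE : a - x = m by rewrite -xm addrC addKr.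
  have pa : ker Y (a + k - x *+ 1).
    by rewrite mulr1n addrAC aE; exact: (subgroupD sK).
  have qba : ker Y (b - a + l - (b - x)).
    suff -> : b - a + l - (b - x) = l - m by exact: KB.
    rewrite -aE opprB [RHS]addrC addrAC; congr (_ + l).
    by rewrite opprB addrC addrA subrK.
  have [a' [ka' a'0 a'b]] := order_unit_good_lift Yu Yf oug cov
    b0 bx ak0 akN0 pa bal0 balN0 qba.
  exists a'; split=> //; rewrite -[a](subrK x) aE -addrA; exact: (subgroupD sK).
Qed.
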